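(* Let $n$ be a positive integer, let $V$ be a real vector space with $\dim V\ge n$, and let $\langle \bullet,\cdots,\bullet\vert\bullet,\cdots,\bullet\rangle : V^{2n}\to\mathbb{R}$ be an $n$-inner product on $V$ (in the sense defined in the context). Then for any vectors $\mathbf{a}_1,\dots,\mathbf{a}_n,\mathbf{b}_1,\dots,\mathbf{b}_n\in V$, $$\langle \mathbf{a}_1,\dots,\mathbf{a}_n\vert \mathbf{b}_1,\dots,\mathbf{b}_n\rangle^2\le \langle \mathbf{a}_1,\dots,\mathbf{a}_n\vert \mathbf{a}_1,\dots,\mathbf{a}_n\rangle\,\langle \mathbf{b}_1,\dots,\mathbf{b}_n\vert \mathbf{b}_1,\dots,\mathbf{b}_n\rangle .$$ Moreover, equality holds if and only if at least one of the following conditions is satisfied: (i) the vectors $\mathbf{a}_1,\dots,\mathbf{a}_n$ are linearly dependent; (ii) the vectors $\mathbf{b}_1,\dots,\mathbf{b}_n$ are linearly dependent; (iii) the vectors $\mathbf{a}_1,\dots,\mathbf{a}_n$ and the vectors $\mathbf{b}_1,\dots,\mathbf{b}_n$ generate the same vector subspace of dimension $n$.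
   Context: Let $n$ be a positive integer and $V$ a real vector space with $\dim V\ge n$ ($V$ may be infinite dimensional). An $n$-inner product on $V$ is a real function $\langle \bullet,\cdots,\bullet\vert\bullet,\cdots,\bullet\rangle$ on $V^{2n}$ ($n$ arguments on each side of the bar) such that: (i) $\langle \mathbf{a}_1,\dots,\mathbf{a}_n\vert \mathbf{a}_1,\dots,\mathbf{a}_n\rangle>0$ if $\mathbf{a}_1,\dots,\mathbf{a}_n$ are linearly independent vectors; (ii) $\langle \mathbf{a}_1,\dots,\mathbf{a}_n\vert \mathbf{b}_1,\dots,\mathbf{b}_n\rangle=\langle \mathbf{b}_1,\dots,\mathbf{b}_n\vert \mathbf{a}_1,\dots,\mathbf{a}_n\rangle$ for any $\mathbf{a}_1,\dots,\mathbf{a}_n,\mathbf{b}_1,\dots,\mathbf{b}_n\in V$; (iii) $\langle \lambda\mathbf{a}_1,\mathbf{a}_2,\dots,\mathbf{a}_n\vert \mathbf{b}_1,\dots,\mathbf{b}_n\rangle=\lambda\langle \mathbf{a}_1,\dots,\mathbf{a}_n\vert \mathbf{b}_1,\dots,\mathbf{b}_n\rangle$ for any scalar $\lambda\in\mathbb{R}$ and any $\mathbf{a}_1,\dots,\mathbf{a}_n,\mathbf{b}_1,\dots,\mathbf{b}_n\in V$; (iv) $\langle \mathbf{a}_1,\dots,\mathbf{a}_n\vert \mathbf{b}_1,\dots,\mathbf{b}_n\rangle=-\langle \mathbf{a}_{\sigma(1)},\dots,\mathbf{a}_{\sigma(n)}\vert \mathbf{b}_1,\dots,\mathbf{b}_n\rangle$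 for any odd permutation $\sigma$ of $\{1,\dots,n\}$ and any $\mathbf{a}_1,\dots,\mathbf{a}_n,\mathbf{b}_1,\dots,\mathbf{b}_n\in V$; (v) $\langle \mathbf{a}_1+\mathbf{c},\mathbf{a}_2,\dots,\mathbf{a}_n\vert \mathbf{b}_1,\dots,\mathbf{b}_n\rangle=\langle \mathbf{a}_1,\mathbf{a}_2,\dots,\mathbf{a}_n\vert \mathbf{b}_1,\dots,\mathbf{b}_n\rangle+\langle \mathbf{c},\mathbf{a}_2,\dots,\mathbf{a}_n\vert \mathbf{b}_1,\dots,\mathbf{b}_n\rangle$ for any $\mathbf{a}_1,\dots,\mathbf{a}_n,\mathbf{b}_1,\dots,\mathbf{b}_n,\mathbf{c}\in V$; (vi) if $\mathbf{a}_1,\mathbf{b}_1,\dots,\mathbf{b}_n\in V$ satisfy $\langle \mathbf{a}_1,\mathbf{b}_1,\dots,\mathbf{b}_{i-1},\mathbf{b}_{i+1},\dots,\mathbf{b}_n\vert \mathbf{b}_1,\dots,\mathbf{b}_n\rangle=0$ for each $i\in\{1,2,\dots,n\}$, then $\langle \mathbf{a}_1,\dots,\mathbf{a}_n\vert \mathbf{b}_1,\dots,\mathbf{b}_n\rangle=0$ for arbitrary vectors $\mathbf{a}_2,\dots,\mathbf{a}_n\in V$. *)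

(* Defs.v *)
From HB Require Import structures.
From mathcomp Require Import all_boot all_order all_fingroup all_algebra.
From mathcomp Require Import boolp classical_sets reals.

Set Implicit Arguments.
Unset Strict Implicit.
Unset Printing Implicit Defensive.

Import Order.TTheory GRing.Theory Num.Theory.

Local Open Scope classical_set_scope.
Local Open Scope ring_scope.

(* [vector.v] only treats finite-dimensional spaces, whereas [V] below is an
   arbitrary [lmodType], so independence and spans are defined here. A family
   with a repeated vector is dependent. *)
Section Families.
Variables (R : realType) (V : lmodType R) (n : nat).

Definition lin_indep (v : 'I_n -> V) : Prop :=
  forall c : 'I_n -> R, \sum_(i < n) c i *: v i = 0 -> forall i, c i = 0.

Definition lin_dep (v : 'I_n -> V) : Prop := ~ lin_indep v.

Definition lin_span (v : 'I_n -> V) : set V :=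
  [set x | exists c : 'I_n -> R, x = \sum_(i < n) c i *: v i].

End Families.

Definition has_dim (R : realType) (V : lmodType R) (n : nat) (S : set V) : Prop :=
  exists e : 'I_n -> V, lin_indep e /\ lin_span e = S.

(* [V] may be infinite-dimensional. *)
Definition dim_at_least (R : realType) (V : lmodType R) (n : nat) : Prop :=
  exists e : 'I_n -> V, lin_indep e.

(* The family (x, a_0, ..., a_(n-1)). *)
Definition fcons (T : Type) (n : nat) (x : T) (a : 'I_n -> T) : 'I_n.+1 -> T :=
  fun i => if unlift ord0 i is Some j then a j else x.

(* The family b with its entry of index i deleted, the order being kept. *)
Definition fdel (T : Type) (n : nat) (i : 'I_n.+1) (b : 'I_n.+1 -> T) : 'I_n -> T :=
  fun j => b (lift i j).

(* An (n + 1)-inner product: n + 1 vectors on each side. The number of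
   arguments on each side is positive, hence a successor. *)
Record is_n_inner_product (R : realType) (V : lmodType R) (n : nat)
    (ip : ('I_n.+1 -> V) -> ('I_n.+1 -> V) -> R) : Prop := IsNInnerProduct {
  ip_gt0 : forall a, lin_indep a -> 0 < ip a a;
  ip_sym : forall a b, ip a b = ip b a;
  ip_scale : forall (l : R) (x : V) (a : 'I_n -> V) b,
    ip (fcons (l *: x) a) b = l * ip (fcons x a) b;
  ip_odd : forall (s : 'S_n.+1) a b,
    odd_perm s -> ip a b = - ip (fun i => a (s i)) b;
  ip_add : forall (x y : V) (a : 'I_n -> V) b,
    ip (fcons (x + y) a) b = ip (fcons x a) b + ip (fcons y a) b;
  ip_orth : forall (x : V) b,
    (forall i : 'I_n.+1, ip (fcons x (fdel i b)) b = 0) ->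
    forall a : 'I_n -> V, ip (fcons x a) b = 0 }.

(* Main.v *)
Require Import Defs.
From HB Require Import structures.
From mathcomp Require Import all_boot all_order all_fingroup all_algebra.
From mathcomp Require Import boolp classical_sets reals.
From mathcomp Require Import ring lra.

Set Implicit Arguments.
Unset Strict Implicit.
Unset Printing Implicit Defensive.

Import Order.TTheory GRing.Theory Num.Theory.

Local Open Scope ring_scope.

(** Call [x] perpendicular to a family [c] when [G a c = 0] for every family
    [a] having [x] among its entries.  If the form [G a b] were known to be the
    determinant of the pairings of the [a i] with the [b j] under an inner
    product on [V], the theorem would follow by splitting off one vector at a
    time.  The axioms retain enough of that inner product for this induction.

    The essential point is [perp_hyperplane]: a vector [x] occurring in an
    independent family has an orthogonal hyperplane, the kernel of a functional
    [f] with [f x = 1], such that [x] is perpendicular to every family of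
    vectors of this kernel.  The last axiom reduces perpendicularity of [x] to
    one family [c] to as many equations as [c] has entries.  The hyperplane is
    obtained by exchange.  If [x] is perpendicular to [c], replacing [c i] by a
    solution [y] of the single linear equation
    [G (upd c i x) (upd c i y) = 0] keeps it so ([perp_upd]); the solutions do
    not depend on the slot [i] ([perp_slot]), hence they do not change under
    the exchange either, and Steinitz exchanges lead to all families of
    solutions ([perp_adapted]).  A first such family comes from a positive
    definite linear system ([perp_complement]).

    The inequality is then proved by induction on the number of arguments.
    Take [x = a ord0] and let [H] be its orthogonal hyperplane.  If all [b i]
    are in [H], then [G a b = 0].  Otherwise both families can be replaced,
    without changing spans and pairings, by [(x, a')] and [(y, b')] with [a']
    and [b'] in [H], up to a permutation of [b].  With [y = f y *: x + h] and
    [G' a' b' = G (x, a') (x, b')], a form on [H] with one argument less on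
    each side, orthogonality gives
<<
      G a b = f y * G' a' b'                G a a = G' a' a'
      G b b = (f y)^2 * G' b' b' + G (h, b') (h, b')
>>
    so the inequality for [G'] implies that for [G].  Equality holds for [G]
    exactly when it holds for [G'] and [h] is in the span of [b'], which says
    that [a] lies in the span of [b] ([cauchy_schwarz_step]). *)

(** * Families of vectors *)

Definition upd (T : Type) (n : nat) (a : 'I_n -> T) (i : 'I_n) (x : T) : 'I_n -> T :=
  fun j => if j == i then x else a j.

Section Update.
Variables (T : Type) (n : nat).
Implicit Types (a : 'I_n -> T) (i j : 'I_n) (x y : T).

Lemma upd_at a i x : upd a i x i = x.
Proof. by rewrite /upd eqxx. Qed.

Lemma upd_off a i j x : j != i -> upd a i x j = a j.
Proof. by rewrite /upd => /negbTE->. Qed.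

Lemma upd_id a i : upd a i (a i) = a.
Proof. by apply/funext => j; rewrite /upd; case: eqP => [->|]. Qed.

Lemma upd_upd a i x y : upd (upd a i x) i y = upd a i y.
Proof. by apply/funext => j; rewrite /upd; case: eqP. Qed.

Lemma updC a i j x y : i != j -> upd (upd a i x) j y = upd (upd a j y) i x.
Proof.
move=> ij; apply/funext => k; rewrite /upd.
by case: (eqVneq k j) => // ->; rewrite eq_sym (negbTE ij).
Qed.

Lemma comp_tperm a i j : a \o tperm i j = upd (upd a i (a j)) j (a i).
Proof.
apply/funext => k; rewrite /upd /=.
by case: tpermP => [->|->|/eqP/negbTE-> /eqP/negbTE->] //; rewrite eqxx //; case: eqP => [->|].
Qed.

End Update.

Section LinearFamilies.
Variables (R : realType) (V : lmodType R) (n : nat).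
Implicit Types (a c : 'I_n -> V) (x y : V) (i : 'I_n).

Lemma sum_delta a i : \sum_j (j == i)%:R *: a j = a i.
Proof.
rewrite (bigD1 i) //= eqxx scale1r big1 ?addr0 // => j /negbTE->.
by rewrite scale0r.
Qed.

Lemma lin_span_mem a i : lin_span a (a i).
Proof. by exists (fun j => (j == i)%:R); rewrite sum_delta. Qed.

Lemma lin_span_lin a (k : R) x y :
  lin_span a x -> lin_span a y -> lin_span a (k *: x + y).
Proof.
move=> [c ->] [d ->]; exists (fun i => k * c i + d i).
by rewrite scaler_sumr -big_split /=; apply: eq_bigr => i _; rewrite scalerDl scalerA.
Qed.

Lemma lin_span0 a : lin_span a 0.
Proof. by exists (fun=> 0); rewrite big1 // => i _; rewrite scale0r. Qed.

Lemma lin_spanZ a (k : R) x : lin_span a x -> lin_span a (k *: x).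
Proof. by move=> ax; rewrite -[_ *: _]addr0; apply: lin_span_lin => //; apply: lin_span0. Qed.

Lemma lin_spanD a x y : lin_span a x -> lin_span a y -> lin_span a (x + y).
Proof. by move=> ax ay; rewrite -[x]scale1r; apply: lin_span_lin. Qed.

Lemma lin_spanB a x y : lin_span a x -> lin_span a y -> lin_span a (x - y).
Proof. by move=> ax ay; rewrite -scaleN1r addrC; apply: lin_span_lin. Qed.

Lemma sum_upd a i x (c : 'I_n -> R) :
  \sum_j c j *: upd a i x j = c i *: x + \sum_(j | j != i) c j *: a j.
Proof.
rewrite (bigD1 i) //= upd_at; congr (_ + _).
by apply: eq_bigr => j ji; rewrite upd_off.
Qed.

Lemma lin_depP a : lin_dep a -> exists2 c : 'I_n -> R,
  \sum_j c j *: a j = 0 & exists i, c i != 0.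
Proof.
move=> /existsNP[c /not_implyP[c0 /existsNP[i /eqP ci]]].
by exists c => //; exists i.
Qed.

Lemma lin_indep_upd_notin a i x : lin_indep a -> ~ lin_span a x -> lin_indep (upd a i x).
Proof.
move=> fa xa c; rewrite sum_upd => c0.
pose d j := if j == i then 0 else c j.
have dE : \sum_(j | j != i) c j *: a j = \sum_j d j *: a j.
  rewrite [RHS](bigD1 i) //= /d eqxx scale0r add0r.
  by apply: eq_bigr => j /negbTE->.
have ci0 : c i = 0.
  apply/eqP/negP => /negP ci; apply: xa; rewrite -[x](scalerK ci); apply: lin_spanZ.
  exists (fun j => - d j); move/eqP: c0; rewrite addr_eq0 dE => /eqP->.
  by rewrite -sumrN; apply: eq_bigr => j _; rewrite scaleNr.
move: c0; rewrite ci0 scale0r add0r dE => /fa d0 j.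
by have := d0 j; rewrite /d; case: eqP => [->|].
Qed.

Lemma lin_indep_perm a (s : 'S_n) : lin_indep a -> lin_indep (a \o s).
Proof.
move=> fa c c0 i; have := fa (c \o (s^-1)%g); rewrite (reindex_inj (@perm_inj _ s)) /=.
rewrite (eq_bigr (fun j => c j *: (a \o s) j)) => [/(_ c0 (s i))|j _]; by rewrite permK.
Qed.

End LinearFamilies.

Lemma lin_span_trans (R : realType) (V : lmodType R) m n (a : 'I_n -> V) (d : 'I_m -> V) x :
  (forall i, lin_span d (a i)) -> lin_span a x -> lin_span d x.
Proof.
move=> ad [c ->]; elim/big_ind: _ => [|u v|i _].
- exact: lin_span0.
- exact: lin_spanD.
- exact: lin_spanZ.
Qed.

Lemma lin_span_perm (R : realType) (V : lmodType R) n (a : 'I_n -> V) (s : 'S_n) x :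
  lin_span (a \o s) x -> lin_span a x.
Proof. by apply: lin_span_trans => i; apply: lin_span_mem. Qed.

(** * Positive alternating forms *)

(** The axioms of an inner product with [n] arguments on each side, stated
    uniformly in the slot.  The arity [n] may be [0], where the form is a
    positive constant: this starts the induction. *)
Record nform (R : realType) (V : lmodType R) (n : nat)
    (G : ('I_n -> V) -> ('I_n -> V) -> R) : Prop := NForm {
  nform_sym : forall a b, G a b = G b a;
  nform_lin : forall a b i (k : R) x y,
    G (upd a i (k *: x + y)) b = k * G (upd a i x) b + G (upd a i y) b;
  nform_alt : forall a b i j, i != j -> a i = a j -> G a b = 0;
  nform_pos : forall a, lin_indep a -> 0 < G a a;
  nform_orth : forall b x, (forall i, G (upd b i x) b = 0) ->
    forall a i, G (upd a i x) b = 0 }.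

Definition perp (R : realType) (V : lmodType R) (n : nat)
    (G : ('I_n -> V) -> ('I_n -> V) -> R) (x : V) (b : 'I_n -> V) : Prop :=
  forall a i, G (upd a i x) b = 0.

Section Forms.
Variables (R : realType) (V : lmodType R) (n : nat).
Variables (G : ('I_n -> V) -> ('I_n -> V) -> R) (GP : nform G).
Implicit Types (a b c d t h : 'I_n -> V) (x y z u v : V) (i j k : 'I_n).

Let Gsym := nform_sym GP.
Let Galt := nform_alt GP.

Lemma formD a b i x y : G (upd a i (x + y)) b = G (upd a i x) b + G (upd a i y) b.
Proof. by rewrite -[x]scale1r (nform_lin GP) mul1r scale1r. Qed.

Lemma form0 a b i : G (upd a i 0) b = 0.
Proof. by have /eqP := formD a b i 0 0; rewrite addr0 -subr_eq0 opprD addNKr oppr_eq0 => /eqP. Qed.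

Lemma formZ a b i (l : R) x : G (upd a i (l *: x)) b = l * G (upd a i x) b.
Proof. by rewrite -[_ *: _]addr0 (nform_lin GP) form0 addr0. Qed.

Lemma formB a b i x y : G (upd a i (x - y)) b = G (upd a i x) b - G (upd a i y) b.
Proof. by rewrite -scaleN1r formD formZ mulN1r. Qed.

Lemma form_sum a b i m (l : 'I_m -> R) (f : 'I_m -> V) :
  G (upd a i (\sum_j l j *: f j)) b = \sum_j l j * G (upd a i (f j)) b.
Proof.
elim/big_rec2: _ => [|j y r _ <-]; first by rewrite form0.
by rewrite (nform_lin GP).
Qed.

Lemma form_dup a b i j : j != i -> G (upd a i (a j)) b = 0.
Proof. by move=> ji; apply: (Galt b ji); rewrite upd_at upd_off. Qed.

Lemma form_comb a b i (l : 'I_n -> R) :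
  G (upd a i (\sum_j l j *: a j)) b = l i * G a b.
Proof.
rewrite form_sum (bigD1 i) //= upd_id big1 ?addr0 // => j ji.
by rewrite form_dup ?mulr0.
Qed.

Lemma form_dep a b : lin_dep a -> G a b = 0.
Proof.
move=> /lin_depP[c c0 [i ci]]; have := form_comb a b i c.
by rewrite c0 form0 => /esym/eqP; rewrite mulf_eq0 (negbTE ci) => /eqP.
Qed.

Lemma form_ge0 a : 0 <= G a a.
Proof.
have [fa|da] := pselect (lin_indep a); first exact/ltW/(nform_pos GP).
by rewrite form_dep.
Qed.

Lemma form_swap a b i j : i != j -> G (a \o tperm i j) b = - G a b.
Proof.
move=> ij; rewrite comp_tperm.
pose B u v := G (upd (upd a i u) j v) b.
have BD u v w : B (u + v) w = B u w + B v w.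
  by rewrite /B (updC a (u + v)) // formD ![upd (upd a j w) i _]updC // eq_sym.
have BDr u v w : B u (v + w) = B u v + B u w by rewrite /B formD.
have B0 u : B u u = 0.
  by apply: (Galt _ ij); rewrite upd_at upd_off // upd_at.
have Ba : B (a i) (a j) = G a b by rewrite /B upd_id upd_id.
have /eqP := B0 (a i + a j).
by rewrite BD !BDr !B0 add0r addr0 addrC addr_eq0 Ba => /eqP.
Qed.

Lemma form_transvection a b i (l : 'I_n -> R) : l i = 0 ->
  G (fun j => a j + l j *: a i) b = G a b.
Proof.
move=> li.
pose f (s : seq 'I_n) j := a j + (if j \in s then l j else 0) *: a i.
suff Gf s : G (f s) b = G a b.
  rewrite -[RHS](Gf (enum 'I_n)); congr (G _ b); apply/funext => j.
  by rewrite /f mem_enum.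
elim: s => [|k s IH].
  by congr (G _ b); apply/funext => j; rewrite /f scale0r addr0.
have [ks|ks] := boolP (k \in s).
  rewrite -IH; congr (G _ b); apply/funext => j.
  by rewrite /f in_cons; case: eqP => [->|//]; rewrite ks.
have -> : f (k :: s) = upd (f s) k (f s k + l k *: a i).
  apply/funext => j; rewrite /upd /f in_cons; case: eqP => [->|//] /=.
  by rewrite (negbTE ks) scale0r addr0.
rewrite formD upd_id IH formZ.
have [->|ki] := eqVneq k i; first by rewrite li mul0r addr0.
have -> : a i = f s i by rewrite /f li if_same scale0r addr0.
by rewrite form_dup ?mulr0 ?addr0 // eq_sym.
Qed.

(** The terms of second and higher order in [u] vanish by alternation, since
    [u] is then a repeated entry. *)
Lemma form_add_line a b (l : 'I_n -> R) u :
  G (fun j => a j + l j *: u) b = G a b + \sum_j l j * G (upd a j u) b.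
Proof.
pose f (s : seq 'I_n) j := a j + (if j \in s then l j else 0) *: u.
suff Gf s : uniq s -> G (f s) b = G a b + \sum_(j <- s) l j * G (upd a j u) b.
  have := Gf (enum 'I_n) (enum_uniq _); rewrite big_enum => <-; congr (G _ b).
  by apply/funext => j; rewrite /f mem_enum.
elim: s => [_|k s IH /andP[ks us]].
  by rewrite big_nil addr0; congr (G _ b); apply/funext => j; rewrite /f scale0r addr0.
have -> : f (k :: s) = upd (f s) k (f s k + l k *: u).
  apply/funext => j; rewrite /upd /f in_cons; case: eqP => [->|//] /=.
  by rewrite (negbTE ks) scale0r addr0.
rewrite formD upd_id IH // formZ big_cons -addrA [_ + l k * _]addrC.
congr (_ + (_ * _ + _)).
rewrite -[RHS](@form_transvection _ b k (fun j => if j \in s then l j else 0)) ?(negbTE ks) //.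
congr (G _ b); apply/funext => j; rewrite upd_at /upd /f.
by case: eqP => [->|//]; rewrite (negbTE ks) scale0r addr0.
Qed.

(** This is the projection onto the span of [b]: by the last axiom it suffices
    to annihilate [n] pairings, and subtracting a multiple of [b j] affects
    only the one with [y] in slot [j]. *)
Lemma perp_proj b y : G b b != 0 ->
  perp G (y - \sum_j (G (upd b j y) b / G b b) *: b j) b.
Proof.
move=> b0; apply: (nform_orth GP) => i.
by rewrite formB form_comb divfK ?subrr.
Qed.

Lemma form_split y b a i : G b b != 0 ->
  G (upd a i y) b = \sum_j G (upd b j y) b / G b b * G (upd a i (b j)) b.
Proof.
move=> b0; have := perp_proj y b0 a i; rewrite formB form_sum => /eqP.
by rewrite subr_eq0 => /eqP.
Qed.

Lemma formDr a b i x y : G a (upd b i (x + y)) = G a (upd b i x) + G a (upd b i y).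
Proof. by rewrite !(Gsym a) formD. Qed.

Lemma formZr a b i (l : R) x : G a (upd b i (l *: x)) = l * G a (upd b i x).
Proof. by rewrite !(Gsym a) formZ. Qed.

Lemma formBr a b i x y : G a (upd b i (x - y)) = G a (upd b i x) - G a (upd b i y).
Proof. by rewrite !(Gsym a) formB. Qed.

Lemma form_swapr a b i j : i != j -> G a (b \o tperm i j) = - G a b.
Proof. by move=> ij; rewrite !(Gsym a) form_swap. Qed.

Lemma form_neq0 a : lin_indep a -> G a a != 0.
Proof. by move=> fa; rewrite gt_eqF ?(nform_pos GP). Qed.

Lemma form_indep a b : G a b != 0 -> lin_indep a.
Proof. by move=> ab; apply: contrapT => /(form_dep b)/eqP; rewrite (negbTE ab). Qed.

(** * The hyperplane orthogonal to a vector *)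

(** The exchange principle.  Let [d] be [c] with [y] in slot [i]; one may take
    [y] such that [G d c = 0].  For each [t], the pairing with
    [e t = upd c i (y + t *: c i)] is again that with a single family, so the
    last axiom applies to [e t] and not only to [c] and [d].  Computing the
    coefficients of the projection of [x] onto the span of [e t] in two ways
    gives [main], where [A] and [B] are positive; comparing [t = 1] with
    [t = -1] forces [G (upd d j x) d = 0]. *)
Lemma perp_upd c x i y : lin_indep c -> perp G x c ->
  G (upd c i x) (upd c i y) = 0 -> perp G x (upd c i y).
Proof.
move=> fc xc; have c0 := form_neq0 fc.
wlog yc : y / G (upd c i y) c = 0 => [IH|].
  pose m := G (upd c i y) c / G c c.
  pose y0 := y - m *: c i.
  have yE : y = y0 + m *: c i by rewrite subrK.
  have c_y0 : G (upd c i y0) c = 0 by rewrite formB formZ upd_id divfK ?subrr.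
  rewrite {1}yE formDr formZr upd_id xc mulr0 addr0 => /(IH _ c_y0) x_y0 a k.
  by rewrite yE formDr formZr upd_id x_y0 xc mulr0 addr0.
move=> xy; set d := upd c i y.
have [fd|/form_dep d0] := pselect (lin_indep d); last first.
  by move=> a k; rewrite Gsym d0.
set A := G d d; have A0 : 0 < A := nform_pos GP fd.
set B := G c c; have B0 : 0 < B := nform_pos GP fc.
have dx j : upd d i x = upd c i x by rewrite /d upd_upd.
apply: (nform_orth GP) => j; have [->|ji] := eqVneq j i; first by rewrite dx.
pose e (t : R) := upd c i (y + t *: c i).
have Ge a (t : R) : G a (e t) = G a d + t * G a c by rewrite /e formDr formZr upd_id.
have cd : G c d = 0 by rewrite Gsym.
have ee (t : R) : G (e t) (e t) = A + t ^+ 2 * B.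
  by rewrite Ge !(Gsym (e t)) !Ge cd yc -/A -/B; ring.
have e_neq0 (t : R) : G (e t) (e t) != 0.
  by rewrite ee gt_eqF // ltr_wpDr // mulr_ge0 ?sqr_ge0 // ltW.
have eij (t : R) : upd d j (e t j) = upd d j (d j) by rewrite /e /d !upd_off.
have main (t : R) : G (upd d j x) d * (A + t ^+ 2 * B)
    = A * (G (upd d j x) d + t * G (upd c j x) d).
  (* On the span of [e t], [x] has no component along [e t i], and its component
     along [e t j] is recovered from the pairing of [upd d j x] with [e t]. *)
  have xd : G (upd d j x) (e t) = G (upd d j x) d by rewrite Ge xc mulr0 addr0.
  have := form_split x d j (e_neq0 t).
  rewrite xd (bigD1 j) //= big1 => [|k kj]; last first.
    have [->|ki] := eqVneq k i.
      by rewrite /e upd_upd -/(e t) Ge xy xc !mulr0 addr0 !mul0r.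
    have -> : e t k = d k by rewrite /e /d !upd_off.
    by rewrite form_dup ?mulr0.
  rewrite eij upd_id (Ge d) yc mulr0 !addr0 ee -/A => xdE.
  have ejx : upd (e t) j x = upd (upd c j x) i (y + t *: c i).
    by rewrite /e updC // eq_sym.
  have ejx' : upd (upd c j x) i (c i) = upd c j x.
    by have -> : c i = upd c j x i; rewrite ?upd_id ?upd_off // eq_sym.
  have E : G (upd (e t) j x) (e t) = G (upd d j x) d + t * G (upd c j x) d.
    rewrite ejx formD formZ ejx' [upd (upd c j x) i y]updC // -/d.
    by rewrite !Ge !xc !mulr0 !addr0.
  by rewrite {1}xdE E -ee; field.
have := main 1; have := main (-1); rewrite sqrrN expr1n => h1 h2.
have : G (upd d j x) d * B = 0 by lra.
by move=> /eqP; rewrite mulf_eq0 (gt_eqF B0) orbF => /eqP.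
Qed.

Lemma perp_notin c x : lin_indep c -> perp G x c -> x != 0 -> ~ lin_span c x.
Proof.
move=> fc xc + [l xE]; rewrite xE big1 ?eqxx // => j _.
have := xc c j; rewrite xE form_comb => /eqP.
by rewrite mulf_eq0 (negbTE (form_neq0 fc)) orbF => /eqP->; rewrite scale0r.
Qed.

(** For [e] in the span of [c i] and [c j], let [T x e] be [c] with [x] in slot
    [i] and [e] in slot [j].  By [perp_upd], [G (T x v) (T z e)] is a multiple
    of [G (T x v) (T x e)], with a factor that does not depend on [v].  The
    factors for [e = c i], [e = c j] and their sum are [p], [0] and [q]; a
    bilinear relation for which every vector is an eigenvector is scalar, so
    [p = q = 0]. *)
Lemma perp_slot c x z i j : lin_indep c -> perp G x c -> x != 0 ->
  G (upd c i x) (upd c i z) = 0 -> G (upd c j x) (upd c j z) = 0.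
Proof.
move=> fc xc x0 zi; have [->//|ij] := eqVneq j i; rewrite eq_sym in ij.
have xNc := perp_notin fc xc x0.
pose T u v := upd (upd c i u) j v.
have TE u v : T u v = upd (upd c j v) i u by rewrite /T updC.
have TDr b u v w : G b (T u (v + w)) = G b (T u v) + G b (T u w) by rewrite formDr.
have TZr b u (l : R) v : G b (T u (l *: v)) = l * G b (T u v) by rewrite formZr.
have TB b u (l : R) w v : G b (T (u - l *: w) v) = G b (T u v) - l * G b (T w v).
  by rewrite !TE formBr formZr.
have Tcj u : T u (c j) = upd c i u.
  by rewrite /T -(upd_off c u (_ : j != i)) ?upd_id // eq_sym.
have Tci u : T u (c i) = upd c j u \o tperm i j.
  by rewrite comp_tperm upd_at upd_off // updC // upd_upd -TE.
(* Adding multiples of [c i] to [c j] preserves its independence and the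
   perpendicularity of [x], so that [perp_upd] also applies to these families. *)
pose cs (l : R) := upd c j (c j + l *: c i).
have Gcs l b : G (cs l) b = G c b by rewrite formD formZ upd_id form_dup ?mulr0 ?addr0.
have fcs l : lin_indep (cs l).
  by apply: (@form_indep _ c); rewrite Gcs form_neq0.
have xcs l : perp G x (cs l) by move=> b k; rewrite Gsym Gcs Gsym.
have fT l : lin_indep (T x (c j + l *: c i)).
  by rewrite TE -/(cs l); apply: lin_indep_upd_notin => //; exact: perp_notin (xcs l) x0.
have GT l : G (T x (c j + l *: c i)) (T x (c j + l *: c i)) != 0 by rewrite form_neq0.
have fx : G (upd c j x) (upd c j x) != 0.
  by apply/form_neq0/lin_indep_upd_notin.
pose p := G (upd c j x) (upd c j z) / G (upd c j x) (upd c j x).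
pose q := G (T x (c j + 1 *: c i)) (T z (c j + 1 *: c i)) /
          G (T x (c j + 1 *: c i)) (T x (c j + 1 *: c i)).
have hj v : G (T x v) (T z (c j)) = 0 by rewrite Tcj TE; apply: perp_upd.
have hi v : G (T x v) (T z (c i)) = p * G (T x v) (T x (c i)).
  apply/eqP; rewrite -subr_eq0 -TB Tci form_swapr // TE oppr_eq0; apply/eqP.
  by apply: perp_upd => //; rewrite formBr formZr /p divfK ?subrr.
have hq v : G (T x v) (T z (c j + 1 *: c i)) = q * G (T x v) (T x (c j + 1 *: c i)).
  apply/eqP; rewrite -subr_eq0 -TB !TE -/(cs 1); apply/eqP.
  by apply: perp_upd => //; rewrite formBr formZr /cs -!TE /q divfK ?subrr.
have rel v : (p - q) * G (T x v) (T x (c i)) = q * G (T x v) (T x (c j)).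
  by have := hq v; rewrite !TDr !TZr hi hj => hqv; lra.
have q0 : q = 0.
  apply/eqP/negP => /negP q0.
  have := GT (- ((p - q) / q)); set w := c j + _; rewrite {2}/w TDr TZr.
  move=> /eqP; apply; apply: (mulfI q0).
  have -> X Y : q * (X + - ((p - q) / q) * Y) = q * X - (p - q) * Y by field.
  by rewrite (rel w) subrr mulr0.
have := rel (c i); rewrite q0 subr0 mul0r Tci form_swap // form_swapr // opprK.
move=> /eqP; rewrite mulf_eq0 (negbTE fx) orbF => /eqP p0.
by have /eqP := p0; rewrite /p mulf_eq0 invr_eq0 (negbTE fx) orbF => /eqP.
Qed.

(** By [form_add_line], correcting the [t j] by multiples of [x] so that [x]
    becomes perpendicular to them is a linear system.  If a nonzero vector [u]
    were in the kernel of its matrix [M], the combination with coefficients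
    [u 0 j] of the families [upd t j x] would pair like a nonzero multiple of a
    single family [t2]; but [t2] is independent, while [G t2 t2] would be [0]. *)
Lemma perp_complement t x : lin_indep t -> ~ lin_span t x ->
  exists c, lin_indep c /\ perp G x c.
Proof.
move=> ft xt.
pose M : 'M[R]_n := \matrix_(i, j) G (upd t i x) (upd t j x).
have uM : M \in unitmx.
  rewrite -row_free_unit -kermx_eq0; apply/rowV0P => u /sub_kermxP uM.
  apply/eqP/negP => /negP /rV0Pn[k uk].
  pose m j := if j == k then 0 else - (u 0 j / u 0 k).
  have mk : m k = 0 by rewrite /m eqxx.
  pose t1 := fun j => t j + m j *: t k.
  have ft1 : lin_indep t1.
    by apply: (@form_indep _ t); rewrite form_transvection ?form_neq0.
  have xt1 : ~ lin_span t1 x.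
    move=> /(@lin_span_trans _ _ _ _ _ t); case/(_ _)/xt => // j.
    by apply: lin_spanD; [exact: lin_span_mem | exact/lin_spanZ/lin_span_mem].
  have := form_neq0 (lin_indep_upd_notin (i := k) ft1 xt1).
  have -> : upd t1 k x = fun j => upd t k x j + m j *: t k.
    by apply/funext => j; rewrite /upd /t1; case: eqP => // ->; rewrite mk scale0r addr0.
  set t2 := (fun j => _).
  have t2E b : u 0 k * G t2 b = \sum_j u 0 j * G (upd t j x) b.
    rewrite form_add_line mulrDr (bigD1 k) //= mk mul0r add0r.
    rewrite [RHS](bigD1 k) //=; congr (_ + _); rewrite mulr_sumr.
    apply: eq_bigr => j jk; rewrite /m (negbTE jk).
    have -> : upd (upd t k x) j (t k) = upd t j x \o tperm k j.
      by rewrite comp_tperm upd_at upd_off 1?eq_sym // [upd (upd t j x) k x]updC // upd_upd.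
    by rewrite form_swap 1?eq_sym // mulrNN mulrA [u 0 k * _]mulrC divfK.
  suff -> : G t2 t2 = 0 by rewrite eqxx.
  apply: (mulfI uk); rewrite mulr0 t2E big1 // => j _.
  rewrite Gsym; apply: (mulfI uk); rewrite mulr0 mulrCA t2E.
  have /rowP/(_ j) := uM; rewrite !mxE => uMj.
  rewrite (eq_bigr (fun i => u 0 i * M i j)) ?uMj ?mulr0 // => i _.
  by rewrite mxE.
pose v := \row_i G (upd t i x) t.
pose l := v *m invmx M.
have lM i : \sum_j l 0 j * G (upd t i x) (upd t j x) = G (upd t i x) t.
  have /rowP/(_ i) : l *m M = v by rewrite mulmxKV.
  by rewrite !mxE => <-; apply: eq_bigr => j _; rewrite (mxE _ _ j i) Gsym.
pose c := fun j => t j + - l 0 j *: x.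
exists c; split; last first.
  apply: (nform_orth GP) => i.
  pose m j := if j == i then 0 else - l 0 j.
  have -> : upd c i x = fun j => upd t i x j + m j *: upd t i x i.
    apply/funext => j; rewrite upd_at /upd /m /c.
    by case: eqP => //; rewrite scale0r addr0.
  rewrite form_transvection ?/m ?eqxx // Gsym form_add_line Gsym -(lM i).
  rewrite -big_split /= big1 // => j _.
  by rewrite mulNr [in X in _ - _ * X]Gsym subrr.
move=> g; rewrite (eq_bigr (fun j => g j *: t j - (g j * l 0 j) *: x)); last first.
  by move=> j _; rewrite /c scalerDr scaleNr scalerN scalerA.
rewrite sumrB -scaler_suml => /eqP; rewrite subr_eq0 => /eqP gE.
have [s0|s0] := eqVneq (\sum_j g j * l 0 j) 0.
  by apply: ft; rewrite gE s0 scale0r.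
case: xt; rewrite -[x](scalerK s0) -gE; apply: lin_spanZ.
by exists g.
Qed.

(** What an exchange preserves: [x] is perpendicular to [e], and the zeros of
    [f] are in the orthogonal hyperplane that [e] determines, seen from any
    slot. *)
Definition adapted (f : V -> R) x e : Prop :=
  [/\ lin_indep e, perp G x e &
      forall i z, f z = 0 -> G (upd e i x) (upd e i z) = 0].

Lemma adapted_upd (f : V -> R) x e i z : x != 0 -> adapted f x e -> f z = 0 ->
  lin_indep (upd e i z) -> adapted f x (upd e i z).
Proof.
move=> x0 [fe xe He] fz fz'.
have xz : perp G x (upd e i z) by apply: perp_upd => //; apply: He.
split=> // j w fw; apply: (@perp_slot _ _ _ i) => //.
by rewrite !upd_upd He.
Qed.

(** Steinitz exchange, by induction on the number of slots where [e] and [h]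
    differ.  A wrong entry [h k] can enter [e] in some slot [i] which is also
    wrong, since otherwise [h k] would be a combination of the other [h j];
    transposing [i] and [k] in [h] then makes slot [i] agree. *)
Lemma perp_adapted (f : V -> R) x e h : x != 0 -> adapted f x e ->
  (forall i, f (h i) = 0) -> perp G x h.
Proof.
move=> x0; have [fh|dh] := pselect (lin_indep h); last first.
  by move=> _ _ a i; rewrite Gsym form_dep.
have [m] := ubnP #|[pred i | e i != h i]|; elim: m => // m IH in e h fh *.
rewrite ltnS => em ade fh0; case: (ade) => fe xe He.
have [k /= ek|eh] := pickP [pred i | e i != h i]; last first.
  by have <- : e = h by apply/funext => i; apply/eqP/negbFE/eh.
have [i ei fei] : exists2 i, e i != h i & lin_indep (upd e i (h k)).
  have [[l hE]|hNe] := pselect (lin_span e (h k)); last first.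
    by exists k => //; apply: lin_indep_upd_notin.
  apply: contrapT => noi.
  have l0 i : e i != h i -> l i = 0.
    move=> ei; apply/eqP/negP => /negP li; apply: noi; exists i => //.
    apply: (@form_indep _ e).
    by rewrite hE form_comb mulf_neq0 ?form_neq0.
  have /(_ (fun j => l j - (j == k)%:R)) := fh.
  have -> : \sum_j (l j - (j == k)%:R) *: h j = 0.
    under eq_bigr do rewrite scalerBl.
    rewrite sumrB sum_delta hE; apply/eqP; rewrite subr_eq0; apply/eqP/eq_bigr => j _.
    by have [->//|/l0->] := eqVneq (e j) (h j); rewrite !scale0r.
  by move=> /(_ erefl k)/eqP; rewrite eqxx l0 // sub0r oppr_eq0 oner_eq0.
suff xh : perp G x (h \o tperm i k).
  move=> a j; have [ik|ik] := eqVneq i k.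
    by have := xh a j; rewrite ik tperm1; congr (G _ _ = 0); apply/funext => q /=; rewrite perm1.
  by have /eqP := xh a j; rewrite form_swapr // oppr_eq0 => /eqP.
apply: IH (adapted_upd x0 ade (fh0 k) fei) _ => [||j]; last exact: fh0.
  exact: lin_indep_perm.
apply: leq_trans em; apply: proper_card; apply/properP; split.
  apply/fintype.subsetP => j; rewrite !inE /= /upd; case: tpermP => [->|->|/eqP/negbTE-> _].
  - by rewrite eqxx eqxx.
  - by rewrite ek.
  - by [].
by exists i; rewrite !inE //= upd_at tpermL eqxx.
Qed.

Lemma slot_functional b c i : G (upd c i (b i)) b != 0 ->
  exists f : {linear V -> R^o}, forall z, f z = G (upd c i z) b / G (upd c i (b i)) b.
Proof.
move=> b0; pose g (z : V) : R^o := G (upd c i z) b / G (upd c i (b i)) b.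
have gl : linear g.
  by move=> l y z; rewrite /g (nform_lin GP) mulrDl -mulrA.
by exists (HB.pack_for {linear V -> R^o} g (GRing.isLinear.Build _ _ _ _ g gl)).
Qed.

(** If some independent family has a span without [x], the functional is the
    equation of the hyperplane determined by the family of [perp_complement].
    Otherwise the space is too small: any functional with value [1] at [x]
    will do, because a family in its kernel, whose span misses [x], is
    dependent and pairs to [0] with everything. *)
Theorem perp_hyperplane a i0 : lin_indep a -> exists f : {linear V -> R^o},
  f (a i0) = 1 /\ forall h, (forall i, f (h i) = 0) -> perp G (a i0) h.
Proof.
move=> fa; set x := a i0.
have x0 : x != 0.
  apply/eqP => x0; have := form_neq0 fa.
  by rewrite -{1}(upd_id a i0) -/x x0 form0 eqxx.
have [[t [ft xt]]|noT] := pselect (exists t, lin_indep t /\ ~ lin_span t x).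
  have [c [fc xc]] := perp_complement ft xt.
  have xx : G (upd c i0 x) (upd c i0 x) != 0.
    by apply/form_neq0/lin_indep_upd_notin => //; exact: perp_notin xc x0.
  have := @slot_functional (upd c i0 x) c i0; rewrite upd_at => /(_ xx)[f fE].
  exists f; split; first by rewrite fE divff.
  move=> h; apply: (perp_adapted (e := c)) => //; split => // i z fz.
  apply: (@perp_slot _ _ _ i0) => //; rewrite Gsym.
  by move/eqP: fz; rewrite fE mulf_eq0 invr_eq0 (negbTE xx) orbF => /eqP.
have := @slot_functional a a i0; rewrite upd_id form_neq0 // => /(_ isT)[f fE].
have fx : f x = 1 by rewrite fE upd_id divff ?form_neq0.
exists f; split => // h fh.
have [ih|dh] := pselect (lin_indep h); last by move=> b i; rewrite Gsym form_dep.
have [[l xE]|xh] := pselect (lin_span h x); last by case: noT; exists h.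
have /eqP := fx; rewrite xE linear_sum big1 => [|j _]; first by rewrite eq_sym oner_eq0.
by rewrite linearZ /= fh scaler0.
Qed.

End Forms.

(** * Prepending a vector *)

Section Fcons.
Variables (T : Type) (n : nat).
Implicit Types (a : 'I_n -> T) (x y : T).

Lemma fcons0 x a : fcons x a ord0 = x.
Proof. by rewrite /fcons unlift_none. Qed.

Lemma fcons_lift x a j : fcons x a (lift ord0 j) = a j.
Proof. by rewrite /fcons liftK. Qed.

Lemma fcons_eq x a (c : 'I_n.+1 -> T) :
  c ord0 = x -> (forall j, c (lift ord0 j) = a j) -> c = fcons x a.
Proof.
move=> c0 cl; apply/funext => i; case: (unliftP ord0 i) => [j ->|->].
  by rewrite fcons_lift.
by rewrite fcons0.
Qed.

Lemma upd_fcons0 x a y : upd (fcons x a) ord0 y = fcons y a.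
Proof. by apply: fcons_eq => [|j]; rewrite ?upd_at // upd_off ?fcons_lift. Qed.

Lemma upd_fcons_lift x a j y : upd (fcons x a) (lift ord0 j) y = fcons x (upd a j y).
Proof.
apply: fcons_eq => [|k]; first by rewrite upd_off ?fcons0.
by rewrite /upd (inj_eq lift_inj) fcons_lift.
Qed.

Lemma upd_slot0 (a : 'I_n.+1 -> T) i x :
  upd a i x = upd (a \o tperm ord0 i) ord0 x \o tperm ord0 i.
Proof.
apply/funext => j; rewrite /= /upd -(inj_eq (@perm_inj _ (tperm ord0 i))) tpermR.
by case: eqP => //= _; rewrite tpermK.
Qed.

End Fcons.

Lemma comp_upd (S T : Type) n (g : S -> T) (a : 'I_n -> S) i x :
  g \o upd a i x = upd (g \o a) i (g x).
Proof. by apply/funext => j; rewrite /= /upd; case: ifP. Qed.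

Section FconsSpan.
Variables (R : realType) (V : lmodType R) (n : nat).
Implicit Types (a : 'I_n -> V) (x z : V).

Lemma sum_fcons x a (c : 'I_n.+1 -> R) :
  \sum_i c i *: fcons x a i = c ord0 *: x + \sum_j c (lift ord0 j) *: a j.
Proof.
rewrite big_ord_recl fcons0; congr (_ + _).
by apply: eq_bigr => j _; rewrite fcons_lift.
Qed.

Lemma lin_span_fconsP x a z :
  lin_span (fcons x a) z <-> exists l, lin_span a (z - l *: x).
Proof.
split=> [[c zE]|[l [c zE]]].
  by exists (c ord0), (c \o lift ord0); rewrite zE sum_fcons addrC addKr.
exists (fcons l c); rewrite sum_fcons fcons0 -[LHS](subrK (l *: x)) addrC zE.
by congr (_ + _); apply: eq_bigr => j _; rewrite fcons_lift.
Qed.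

Lemma lin_indep_fcons x a : lin_indep a -> ~ lin_span a x -> lin_indep (fcons x a).
Proof.
move=> fa xa c; rewrite sum_fcons => c0.
have c00 : c ord0 = 0.
  apply/eqP/negP => /negP cx; apply: xa; rewrite -[x](scalerK cx).
  apply: lin_spanZ; exists (fun j => - c (lift ord0 j)).
  move/eqP: c0; rewrite addr_eq0 => /eqP->; rewrite -sumrN.
  by apply: eq_bigr => j _; rewrite scaleNr.
move: c0; rewrite c00 scale0r add0r => /(fa (c \o lift ord0)) cl i.
by case: (unliftP ord0 i) => [j ->|->//]; apply: cl.
Qed.

Lemma lin_indep_fcons_tail x a : lin_indep (fcons x a) -> lin_indep a.
Proof.
move=> fxa c c0 j; have := fxa (fcons 0 c); rewrite sum_fcons fcons0 scale0r add0r.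
rewrite (eq_bigr (fun j => c j *: a j)) => [/(_ c0 (lift ord0 j))|i _]; by rewrite fcons_lift.
Qed.

Lemma lin_indep_fcons_notin x a : lin_indep (fcons x a) -> ~ lin_span a x.
Proof.
move=> fxa [c xE]; have := fxa (fcons (-1) c); rewrite sum_fcons fcons0 scaleN1r {1}xE.
rewrite [X in _ + X](eq_bigr (fun j => c j *: a j)) => [|i _]; last by rewrite fcons_lift.
rewrite addrC subrr => /(_ erefl ord0)/eqP.
by rewrite fcons0 oppr_eq0 oner_eq0.
Qed.

End FconsSpan.

(** * The form restricted to a hyperplane *)

Section Kernel.
Variables (R : realType) (V : lmodType R) (f : {linear V -> R^o}).

Definition in_kernel : {pred V} := fun z => f z == 0.

Lemma in_kernel_closed : submod_closed in_kernel.
Proof.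
split=> [|l y z]; rewrite !unfold_in ?linear0 // => /eqP y0 /eqP z0.
by rewrite /in_kernel linearP y0 z0 scaler0 addr0.
Qed.

HB.instance Definition _ := GRing.isSubmodClosed.Build R V in_kernel in_kernel_closed.

Record kernel := Kernel { kval : V; _ : kval \in in_kernel }.
HB.instance Definition _ := [isSub for kval].
HB.instance Definition _ := [Choice of kernel by <:].
HB.instance Definition _ := [SubChoice_isSubLmodule of kernel by <:].

Lemma kernelP (z : kernel) : f (kval z) = 0.
Proof. by case: z => z /= /eqP. Qed.

Lemma kval_comb n (c : 'I_n -> R) (a : 'I_n -> kernel) :
  kval (\sum_j c j *: a j) = \sum_j c j *: (kval \o a) j.
Proof. by rewrite [LHS](linear_sum (\val : kernel -> V)). Qed.

Lemma lin_span_kval n (a : 'I_n -> kernel) z :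
  lin_span (kval \o a) (kval z) <-> lin_span a z.
Proof.
split=> -[c zE]; exists c; last by rewrite zE kval_comb.
by apply: val_inj; rewrite /= kval_comb.
Qed.

Lemma lin_indep_kval n (a : 'I_n -> kernel) : lin_indep (kval \o a) <-> lin_indep a.
Proof.
split=> fa c c0; apply: fa; first by rewrite -kval_comb c0.
by apply: val_inj; rewrite /= kval_comb c0.
Qed.

Lemma span_kernel n (a : 'I_n -> kernel) z : lin_span (kval \o a) z -> f z = 0.
Proof.
move=> [c ->]; rewrite linear_sum big1 // => j _.
by rewrite linearZ /= kernelP scaler0.
Qed.

Lemma span_fcons_kernel n (a : 'I_n -> kernel) y z :
  f y != 0 -> f z = 0 -> lin_span (fcons y (kval \o a)) z -> lin_span (kval \o a) z.
Proof.
move=> fy fz /lin_span_fconsP[l az]; have /eqP := span_kernel az.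
rewrite linearB linearZ /= fz sub0r oppr_eq0 mulf_eq0 (negbTE fy) orbF => /eqP l0.
by move: az; rewrite l0 scale0r subr0.
Qed.

Section Restriction.
Variables (x : V) (fx : f x = 1).

Lemma kernel_proj_subproof z : z - (f z : R) *: x \in in_kernel.
Proof. by rewrite unfold_in /in_kernel linearB linearZ /= fx [_ *: _]mulr1 subrr. Qed.

Definition kernel_proj z := Kernel (kernel_proj_subproof z).

Lemma kernel_proj_id z : f z = 0 -> kval (kernel_proj z) = z.
Proof. by move=> /= ->; rewrite scale0r subr0. Qed.

Variables (n : nat) (G : ('I_n.+1 -> V) -> ('I_n.+1 -> V) -> R).
Hypotheses (GP : nform G)
  (xK : forall h, (forall i, f (h i) = 0) -> perp G x h).

Definition restrict (a b : 'I_n -> kernel) : R :=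
  G (fcons x (kval \o a)) (fcons x (kval \o b)).

Lemma x_notin_span (a : 'I_n -> kernel) : ~ lin_span (kval \o a) x.
Proof. by move=> /span_kernel/eqP; rewrite fx oner_eq0. Qed.

Lemma f_fcons_kernel (h : kernel) (a : 'I_n -> kernel) i :
  f (fcons (kval h) (kval \o a) i) = 0.
Proof. by case: (unliftP ord0 i) => [j ->|->]; rewrite ?fcons0 ?fcons_lift /= kernelP. Qed.

Lemma fcons_perp a (h : kernel) (b : 'I_n -> kernel) :
  G (fcons x a) (fcons (kval h) (kval \o b)) = 0.
Proof.
rewrite -[fcons x a](upd_fcons0 x); apply: xK => i; exact: f_fcons_kernel.
Qed.

(** For the last axiom, a vector [y] of the kernel satisfying the conditions
    relative to [b] must also satisfy the remaining condition relative to
    [(x, b)], the one with [y] in place of [x]; this is [fcons_perp]. *)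
Lemma restrict_nform : nform restrict.
Proof.
split.
- by move=> a b; apply: nform_sym GP _ _.
- move=> a b i l y z; rewrite /restrict !comp_upd -!upd_fcons_lift /=.
  exact: (nform_lin GP).
- move=> a b i j ij aij.
  have lij : lift ord0 i != lift ord0 j by rewrite (inj_eq lift_inj).
  by apply: (nform_alt GP _ lij); rewrite !fcons_lift /= aij.
- move=> a /lin_indep_kval fa; apply: (nform_pos GP).
  exact/lin_indep_fcons/x_notin_span.
- move=> b y yb a i; rewrite /restrict comp_upd -upd_fcons_lift.
  apply: (nform_orth GP) => j; case: (unliftP ord0 j) => [k ->|->].
    by rewrite upd_fcons_lift -comp_upd; apply: yb.
  by rewrite upd_fcons0 (nform_sym GP); apply: fcons_perp.
Qed.

(** The cross terms between [x] and [h] vanish by [fcons_perp], so [G v v] is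
    that of [(f y *: x, b)] plus the nonnegative [G w w], which vanishes
    exactly when [h] is in the span of [b]. *)
Lemma cauchy_schwarz_step (a b : 'I_n -> kernel) y : f y != 0 -> lin_indep a -> lin_indep b ->
  let u := fcons x (kval \o a) in let v := fcons y (kval \o b) in
  (restrict a b ^+ 2 <= restrict a a * restrict b b /\
  (restrict a b ^+ 2 = restrict a a * restrict b b <-> forall i, lin_span b (a i))) ->
  G u v ^+ 2 <= G u u * G v v /\
  (G u v ^+ 2 = G u u * G v v <-> forall i, lin_span v (u i)).
Proof.
move=> fy fa fb u v [le_ab eq_ab].
pose h := kernel_proj y; pose w := fcons (kval h) (kval \o b).
have yE : y = f y *: x + kval h by rewrite addrC subrK.
have vE c : G v c = f y * G (fcons x (kval \o b)) c + G w c.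
  have -> : v = upd w ord0 (f y *: x + kval h) by rewrite upd_fcons0 -yE.
  by rewrite (nform_lin GP) !upd_fcons0.
have wx c : G w (fcons x c) = 0 by rewrite (nform_sym GP) fcons_perp.
have Guv : G u v = f y * restrict a b.
  by rewrite (nform_sym GP) vE wx addr0 (nform_sym GP).
have Gvv : G v v = f y ^+ 2 * restrict b b + G w w.
  rewrite vE (nform_sym GP _ v) (nform_sym GP w v) !vE wx fcons_perp mulr0 add0r addr0.
  by rewrite mulrA.
have p0 : 0 < restrict a a := nform_pos restrict_nform fa.
have r0 : 0 <= G w w := form_ge0 GP w.
have fy2 : 0 < f y ^+ 2 by rewrite exprn_even_gt0.
rewrite Guv Gvv -/(restrict a a) exprMn; split.
  have : 0 <= f y ^+ 2 * (restrict a a * restrict b b - restrict a b ^+ 2).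
    by apply: mulr_ge0; [exact: ltW | rewrite subr_ge0].
  have : 0 <= restrict a a * G w w by rewrite mulr_ge0 // ltW.
  by lra.
have wP : G w w = 0 <-> lin_span b h.
  split=> [w0|/lin_span_kval bh].
    apply: contrapT => bh; have : 0 < G w w; last by rewrite w0 ltxx.
    by apply/(nform_pos GP)/lin_indep_fcons; [exact/lin_indep_kval | move/lin_span_kval].
  by apply: (form_dep GP) => /lin_indep_fcons_notin.
have eqP' : f y ^+ 2 * restrict a b ^+ 2 = restrict a a * (f y ^+ 2 * restrict b b + G w w)
    <-> restrict a b ^+ 2 = restrict a a * restrict b b /\ G w w = 0.
  split=> [E|[-> ->]]; last by rewrite addr0 mulrCA.
  have r_pos : 0 <= restrict a a * G w w by rewrite mulr_ge0 // ltW.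
  have s_pos : 0 <= f y ^+ 2 * (restrict a a * restrict b b - restrict a b ^+ 2).
    by apply: mulr_ge0; [exact: ltW | rewrite subr_ge0].
  have /eqP : restrict a a * G w w = 0 by lra.
  have /eqP : f y ^+ 2 * (restrict a a * restrict b b - restrict a b ^+ 2) = 0 by lra.
  rewrite mulf_eq0 (gt_eqF fy2) /= subr_eq0 => /eqP->.
  by rewrite mulf_eq0 (gt_eqF p0) => /eqP->.
have vy : lin_span v y by have := lin_span_mem v ord0; rewrite {2}/v fcons0.
rewrite eqP' eq_ab wP; split=> [[ba bh] i|va].
  have vb z : lin_span (kval \o b) z -> lin_span v z.
    by move=> bz; apply/lin_span_fconsP; exists 0; rewrite scale0r subr0.
  case: (unliftP ord0 i) => [j ->|->].
    by rewrite /u fcons_lift; apply/vb/lin_span_kval.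
  rewrite /u fcons0 -[x](scalerK fy); apply: lin_spanZ.
  have -> : f y *: x = y - kval h by rewrite opprB addrC subrK.
  by apply: lin_spanB; last exact/vb/lin_span_kval.
have vx : lin_span v x by have := va ord0; rewrite /u fcons0.
split=> [j|].
  apply/lin_span_kval/span_fcons_kernel; rewrite ?kernelP //.
    exact: fy.
  by have := va (lift ord0 j); rewrite /u fcons_lift.
apply/lin_span_kval/span_fcons_kernel; rewrite ?kernelP //; first exact: fy.
by apply: lin_spanB; last exact: lin_spanZ.
Qed.

End Restriction.
End Kernel.
Arguments kval {R V f} _.

(** * Induction on the number of arguments *)

Lemma form_fcons (R : realType) (V : lmodType R) n
    (G : ('I_n.+1 -> V) -> ('I_n.+1 -> V) -> R) (GP : nform G)
    (a : 'I_n.+1 -> V) (l : 'I_n -> R) c :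
  let a' := fcons (a ord0) (fun j => a (lift ord0 j) + l j *: a ord0) in
  G a' c = G a c /\ forall z, lin_span a' z <-> lin_span a z.
Proof.
move=> a'; pose m := fcons 0 l.
have a'E : a' = fun i => a i + m i *: a ord0.
  apply/esym/fcons_eq => [|j]; first by rewrite /m fcons0 scale0r addr0.
  by rewrite /m fcons_lift.
split; first by rewrite a'E (form_transvection GP) // /m fcons0.
have a0 : lin_span a' (a ord0) by have := lin_span_mem a' ord0; rewrite {2}/a' fcons0.
move=> z; split; apply: lin_span_trans => i.
  rewrite a'E; apply: lin_spanD; first exact: lin_span_mem.
  exact/lin_spanZ/lin_span_mem.
have -> : a i = a' i - m i *: a ord0 by rewrite a'E addrK.
by apply: lin_spanB; [exact: lin_span_mem | exact: lin_spanZ].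
Qed.

(** One inclusion of spans suffices in the equality case: exchanging [a] and
    [b] gives the other one. *)
Theorem nform_cauchy_schwarz (R : realType) n (V : lmodType R)
    (G : ('I_n -> V) -> ('I_n -> V) -> R) (GP : nform G) (a b : 'I_n -> V) :
  lin_indep a -> lin_indep b ->
  G a b ^+ 2 <= G a a * G b b /\
  (G a b ^+ 2 = G a a * G b b <-> forall i, lin_span b (a i)).
Proof.
elim: n => [|n IH] in V G GP a b *.
  move=> _ _; have -> : a = b by apply/funext => -[].
  by split; [|split] => // _ [].
move=> fa fb; have [f [fx xK]] := perp_hyperplane GP ord0 fa.
set x := a ord0 in fx xK.
have [fb0|[k fbk]] : (forall i, f (b i) = 0) \/ exists k, f (b k) != 0.
  have [|/existsNP[k /eqP fbk]] := pselect (forall i, f (b i) = 0); first by left.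
  by right; exists k.
  have Gab : G a b = 0 by rewrite -(upd_id a ord0) xK.
  have Gpos : 0 < G a a * G b b by rewrite mulr_gt0 ?(nform_pos GP).
  rewrite Gab expr0n /= ltW //; split=> //; split=> [E|/(_ ord0)[c xE]].
    by rewrite -E ltxx in Gpos.
  move/eqP: fx; rewrite /x xE linear_sum big1 => [|j _]; first by rewrite eq_sym oner_eq0.
  by rewrite linearZ /= fb0 scaler0.
wlog k0 : b k fb fbk / k = ord0.
  move=> wl; have [k0|k0] := eqVneq k ord0; first exact: wl k0.
  have := wl (b \o tperm k ord0) ord0; rewrite /= tpermR => /(_ _ fbk erefl) [].
    exact: lin_indep_perm.
  rewrite !(form_swap GP) // !(form_swapr GP) // opprK sqrrN => -> ->; split=> //.
  split=> H i; first exact: lin_span_perm (H i).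
  apply: (@lin_span_perm _ _ _ _ (tperm k ord0)).
  have := H i; congr lin_span; apply/funext => j /=; by rewrite tpermK.
rewrite {}k0 in fbk; set y := b ord0 in fbk.
(* The multiples of [x] and [y] that bring the other entries into the kernel *)
pose l (j : 'I_n) : R := - f (a (lift ord0 j)).
pose m (j : 'I_n) : R := - (f (b (lift ord0 j)) / f y).
pose a' (j : 'I_n) := kernel_proj fx (a (lift ord0 j) + l j *: x).
pose b' (j : 'I_n) := kernel_proj fx (b (lift ord0 j) + m j *: y).
have a'E : kval \o a' = fun j => a (lift ord0 j) + l j *: x.
  apply/funext => j; apply: kernel_proj_id.
  by rewrite linearD linearZ /= fx [_ *: _]mulr1 subrr.
have b'E : kval \o b' = fun j => b (lift ord0 j) + m j *: y.
  apply/funext => j; apply: kernel_proj_id.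
  by rewrite linearD linearZ /= [_ *: _]mulNr divfK // subrr.
pose u := fcons x (kval \o a'); pose v := fcons y (kval \o b').
have Gu c : G u c = G a c by rewrite /u a'E; case: (form_fcons GP a l c).
have Gv c : G v c = G b c by rewrite /v b'E; case: (form_fcons GP b m c).
have Su z : lin_span u z <-> lin_span a z.
  by rewrite /u a'E; case: (form_fcons GP a l a) => _; apply.
have Sv z : lin_span v z <-> lin_span b z.
  by rewrite /v b'E; case: (form_fcons GP b m b) => _; apply.
have fa' : lin_indep a'.
  apply/lin_indep_kval/(@lin_indep_fcons_tail _ _ _ x)/(form_indep GP (b := a)).
  by rewrite Gu form_neq0.
have fb' : lin_indep b'.
  apply/lin_indep_kval/(@lin_indep_fcons_tail _ _ _ y)/(form_indep GP (b := b)).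
  by rewrite Gv form_neq0.
have := cauchy_schwarz_step fx GP xK fbk fa' fb' (IH _ _ (restrict_nform fx GP xK) a' b' fa' fb').
have Guu : G u u = G a a by rewrite Gu (nform_sym GP) Gu.
have Gvv : G v v = G b b by rewrite Gv (nform_sym GP) Gv.
have Guv : G u v = G a b by rewrite Gu (nform_sym GP) Gv (nform_sym GP).
rewrite -/u -/v Guu Gvv Guv => -[le_ab eq_ab].
split=> //; rewrite eq_ab; split=> [H i|H i].
  apply/Sv/(lin_span_trans H)/Su; exact: lin_span_mem.
apply: (lin_span_trans (a := a)) => [j|]; last exact/Su/lin_span_mem.
exact/Sv/H.
Qed.

(** * n-inner products *)

Section NInnerProduct.
Variables (R : realType) (V : lmodType R) (n : nat).
Variables (ip : ('I_n.+1 -> V) -> ('I_n.+1 -> V) -> R) (ipP : is_n_inner_product ip).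

(** An even permutation is a product of two odd ones, unless there is only one
    slot, where it is the identity. *)
Lemma ip_perm (s : 'S_n.+1) a b : ip (a \o s) b = (-1) ^+ s * ip a b.
Proof.
have odd_ip t c : odd_perm t -> ip (c \o t) b = - ip c b.
  by move=> ot; rewrite (ip_odd ipP c b ot) opprK.
case: (boolP (odd_perm s)) => [os|es]; first by rewrite expr1 mulN1r odd_ip.
rewrite expr0 mul1r; have [[i [j ij]]|noij] := pselect (exists i j : 'I_n.+1, i != j).
  have ot : odd_perm (tperm i j) by rewrite odd_tperm.
  have -> : a \o s = (a \o (tperm i j * s)%g) \o tperm i j.
    by apply/funext => k; rewrite /= permM tpermK.
  by rewrite odd_ip // odd_ip ?opprK // odd_permM ot (negbTE es).
congr (ip _ b); apply/funext => k /=; congr a; apply/eqP/negPn/negP => sk.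
by apply: noij; exists (s k), k.
Qed.

(** The axioms of an n-inner product single out the first slot; conjugating by
    the transposition of [ord0] and [i] carries them to slot [i]. *)
Lemma n_inner_product_nform : nform ip.
Proof.
have fdelE (a : 'I_n.+1 -> V) y : upd a ord0 y = fcons y (fdel ord0 a).
  by apply: fcons_eq => [|j]; rewrite ?upd_at // upd_off.
split.
- exact: ip_sym ipP.
- have lin0 a b (k : R) x y :
      ip (upd a ord0 (k *: x + y)) b = k * ip (upd a ord0 x) b + ip (upd a ord0 y) b.
    by rewrite !fdelE (ip_add ipP) (ip_scale ipP).
  by move=> a b i k x y; rewrite !(upd_slot0 a i) 3!ip_perm lin0 mulrDr mulrCA.
- move=> a b i j ij aij.
  have := ip_perm (tperm i j) a b; rewrite odd_tperm ij expr1 mulN1r.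
  rewrite comp_tperm -aij upd_id aij upd_id => E; lra.
- exact: ip_gt0 ipP.
- move=> b x xb a i.
  have xb0 c : ip (fcons x c) b = 0.
    apply: (ip_orth ipP) => j.
    (* [lift_perm ord0 j 1] moves slot [j] to the front and keeps the order of
       the others *)
    have -> : fcons x (fdel j b) = upd b j x \o lift_perm ord0 j 1.
      apply/esym/fcons_eq => [|k] /=; first by rewrite lift_perm_id upd_at.
      by rewrite lift_perm_lift perm1 upd_off // eq_sym neq_lift.
    by rewrite ip_perm xb mulr0.
  by rewrite upd_slot0 ip_perm fdelE xb0 mulr0.
Qed.

End NInnerProduct.

Theorem theorem2p1 (R : realType) (V : lmodType R) (n : nat)
    (dimV : dim_at_least V n.+1)
    (ip : ('I_n.+1 -> V) -> ('I_n.+1 -> V) -> R)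
    (ipP : is_n_inner_product ip)
    (a b : 'I_n.+1 -> V) :
  ip a b ^+ 2 <= ip a a * ip b b /\
  (ip a b ^+ 2 = ip a a * ip b b <->
    [\/ lin_dep a,
        lin_dep b
      | lin_span a = lin_span b /\ has_dim n.+1 (lin_span a)]).
Proof.
have GP := n_inner_product_nform ipP.
have [fa|da] := pselect (lin_indep a); last first.
  rewrite !(form_dep GP _ da) expr0n mul0r /=; split=> //; split=> // _.
  by constructor 1.
have [fb|db] := pselect (lin_indep b); last first.
  rewrite (nform_sym GP) !(form_dep GP _ db) expr0n mulr0 /=; split=> //; split=> // _.
  by constructor 2.
have [le_ab ab] := nform_cauchy_schwarz GP fa fb.
have [_ ba] := nform_cauchy_schwarz GP fb fa.
split=> //; split=> [E|[//|//|[Sab _]]].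
  constructor 3; split; last by exists a.
  apply/seteqP; split=> z; apply: lin_span_trans; first exact/ab.
  by apply/ba; rewrite (nform_sym GP) mulrC.
by apply/ab => i; rewrite -Sab; apply: lin_span_mem.
Qed.
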